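(* Let $A$ and $B$ be $C^*$-algebras, let $E$ be an $A$-$B$-equivalence bimodule, and let $g\in E$. Then the following are equivalent: (1) $\Theta_g : E\to E$, $\Theta_g f={}_\bullet\langle f,g\rangle g$, is invertible. (2) $\Phi_g^B(\Phi_g^B)^* : B\to B$ is an isomorphism, where $\Phi_g^B:E\to B$, $\Phi_g^B f=\langle g,f\rangle_\bullet$.
   Context: An $A$-$B$-equivalence bimodule is an $A$-$B$-bimodule $E$ that is a left Hilbert $A$-module with $A$-valued inner product ${}_\bullet\langle\cdot,\cdot\rangle$ (linear in the first variable) and a right Hilbert $B$-module with $B$-valued inner product $\langle\cdot,\cdot\rangle_\bullet$ (linear in the second variable) such that: (i) the linear span of $\{{}_\bullet\langle f,g\rangle: f,g\in E\}$ is dense in $A$ and the linear span of $\{\langle f,g\rangle_\bullet: f,g\in E\}$ is dense in $B$; (ii) $\langle af,g\rangle_\bullet=\langle f,a^*g\rangle_\bullet$ and ${}_\bullet\langle fb,g\rangle={}_\bullet\langle f,gb^*\rangle$ for all $f,g\in E$, $a\in A$, $b\in B$; (iii) ${}_\bullet\langle f,g\rangle h=f\langle g,h\rangle_\bullet$ for all $f,g,h\in E$. The operator $\Phi_g^B$ is $B$-adjointable, where $B$ is regarded as a right Hilbert module over itself, with adjoint $(\Phi_g^B)^*:B\to E$, $b\mapsto g\cdot b$. The algebras $A,B$ are not assumed unital. *)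

(* Defs.v *)
From HB Require Import structures.
From mathcomp Require Import all_boot all_order all_algebra.
From mathcomp Require Import complex.
From mathcomp Require Import all_classical all_reals all_analysis.

Set Implicit Arguments.
Unset Strict Implicit.
Unset Printing Implicit Defensive.

Import Order.TTheory GRing.Theory Num.Theory.
Import numFieldNormedType.Exports.

Local Open Scope classical_set_scope.
Local Open Scope ring_scope.
Local Open Scope complex_scope.

(* C*-algebras over R[i], not assumed unital (so the product is not that of a
   MathComp ring) and possibly zero. *)
HB.mixin Record isCStarAlgebra (R : realType) A
    of CompleteNormedModule R[i] A := {
  amul : A -> A -> A;
  astar : A -> A;
  amulA : forall a b c : A, amul a (amul b c) = amul (amul a b) c;
  amulDl : forall a b c : A, amul (a + b) c = amul a c + amul b c;
  amulDr : forall a b c : A, amul a (b + c) = amul a b + amul a c;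
  amulZl : forall (k : R[i]) (a b : A), amul (k *: a) b = k *: amul a b;
  amulZr : forall (k : R[i]) (a b : A), amul a (k *: b) = k *: amul a b;
  astarK : forall a : A, astar (astar a) = a;
  astarD : forall a b : A, astar (a + b) = astar a + astar b;
  astarZ : forall (k : R[i]) (a : A), astar (k *: a) = Num.conj k *: astar a;
  astarM : forall a b : A, astar (amul a b) = amul (astar b) (astar a);
  norm_amul : forall a b : A, `|amul a b| <= `|a| * `|b|;
  norm_astar_amul : forall a : A, `|amul (astar a) a| = `|a| ^+ 2
}.

#[short(type="cstarAlgType")]
HB.structure Definition CStarAlgebra (R : realType) :=
  {A of CompleteNormedModule R[i] A & isCStarAlgebra R A}.

(* Positivity in a C*-algebra; avoids spectra, which would need a unitization. *)
Definition apos (R : realType) (A : cstarAlgType R) (a : A) : Prop :=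
  exists b : A, a = amul (astar b) b.

Definition ip_norm (R : realType) (A : cstarAlgType R) (E : Type)
    (ip : E -> E -> A) (f : E) : R[i] := sqrtC `|ip f f|.

(* [V] is complete for the metric [N (f - g)]. *)
Definition complete_for (R : realType) (V : zmodType) (N : V -> R[i]) : Prop :=
  forall u : nat -> V,
    (forall e : R[i], 0 < e -> exists n0 : nat, forall m n : nat,
       (n0 <= m)%N -> (n0 <= n)%N -> N (u m - u n) < e) ->
    exists l : V, forall e : R[i], 0 < e -> exists n0 : nat, forall n : nat,
      (n0 <= n)%N -> N (u n - l) < e.

HB.mixin Record isLeftHilbert (R : realType) (A : cstarAlgType R) E
    of GRing.Lmodule R[i] E := {
  lact : A -> E -> E;
  lactDl : forall (a b : A) (f : E), lact (a + b) f = lact a f + lact b f;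
  lactDr : forall (a : A) (f g : E), lact a (f + g) = lact a f + lact a g;
  lactZl : forall (k : R[i]) (a : A) (f : E), lact (k *: a) f = k *: lact a f;
  lactZr : forall (k : R[i]) (a : A) (f : E), lact a (k *: f) = k *: lact a f;
  lactA : forall (a b : A) (f : E), lact (amul a b) f = lact a (lact b f);
  lip : E -> E -> A;
  lipDl : forall f g h : E, lip (f + g) h = lip f h + lip g h;
  lipZl : forall (k : R[i]) (f g : E), lip (k *: f) g = k *: lip f g;
  lip_act : forall (a : A) (f g : E), lip (lact a f) g = amul a (lip f g);
  lipC : forall f g : E, astar (lip f g) = lip g f;
  lip_pos : forall f : E, apos (lip f f);
  lip_eq0 : forall f : E, lip f f = 0 -> f = 0;
  lip_complete : complete_for (ip_norm lip)
}.

#[short(type="leftHilbertType")]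
HB.structure Definition LeftHilbert (R : realType) (A : cstarAlgType R) :=
  {E of GRing.Lmodule R[i] E & isLeftHilbert R A E}.

HB.mixin Record isRightHilbert (R : realType) (B : cstarAlgType R) E
    of GRing.Lmodule R[i] E := {
  ract : E -> B -> E;
  ractDl : forall (f g : E) (b : B), ract (f + g) b = ract f b + ract g b;
  ractDr : forall (f : E) (a b : B), ract f (a + b) = ract f a + ract f b;
  ractZl : forall (k : R[i]) (f : E) (b : B), ract (k *: f) b = k *: ract f b;
  ractZr : forall (k : R[i]) (f : E) (b : B), ract f (k *: b) = k *: ract f b;
  ractA : forall (f : E) (a b : B), ract f (amul a b) = ract (ract f a) b;
  rip : E -> E -> B;
  ripDr : forall f g h : E, rip f (g + h) = rip f g + rip f h;
  ripZr : forall (k : R[i]) (f g : E), rip f (k *: g) = k *: rip f g;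
  rip_act : forall (f g : E) (b : B), rip f (ract g b) = amul (rip f g) b;
  ripC : forall f g : E, astar (rip f g) = rip g f;
  rip_pos : forall f : E, apos (rip f f);
  rip_eq0 : forall f : E, rip f f = 0 -> f = 0;
  rip_complete : complete_for (ip_norm rip)
}.

#[short(type="rightHilbertType")]
HB.structure Definition RightHilbert (R : realType) (B : cstarAlgType R) :=
  {E of GRing.Lmodule R[i] E & isRightHilbert R B E}.

Definition lin_span (K : pzRingType) (V : lmodType K) (X : set V) : set V :=
  [set v | exists (n : nat) (c : 'I_n -> K) (x : 'I_n -> V),
     (forall i, X (x i)) /\ v = \sum_(i < n) c i *: x i].

HB.mixin Record isEquivBimod (R : realType) (A B : cstarAlgType R) E
    of LeftHilbert R A E & RightHilbert R B E := {
  lractA : forall (a : A) (f : E) (b : B),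
    ract (lact a f) b = lact a (ract f b);
  lip_dense : dense (lin_span [set a : A | exists f g : E, a = lip f g]);
  rip_dense : dense (lin_span [set b : B | exists f g : E, b = rip f g]);
  rip_lact : forall (a : A) (f g : E),
    rip (lact a f) g = rip f (lact (astar a) g) :> B;
  lip_ract : forall (f g : E) (b : B),
    lip (ract f b) g = lip f (ract g (astar b)) :> A;
  lip_rip : forall f g h : E, lact (lip f g : A) h = ract f (rip g h : B)
}.

#[short(type="equivBimodType")]
HB.structure Definition EquivBimod (R : realType) (A B : cstarAlgType R) :=
  {E of LeftHilbert R A E & RightHilbert R B E & isEquivBimod R A B E}.

Section HilbertOperators.
Variables (R : realType) (A B : cstarAlgType R).

Definition ladjoint (E F : leftHilbertType A) (T : E -> F) (S : F -> E) : Prop :=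
  forall (x : E) (y : F), lip (T x) y = lip x (S y) :> A.

Definition ladjointable (E F : leftHilbertType A) (T : E -> F) : Prop :=
  exists S : F -> E, ladjoint T S.

(* [T] has a two-sided inverse among the A-adjointable operators. *)
Definition linvertible (E F : leftHilbertType A) (T : E -> F) : Prop :=
  ladjointable T /\
  exists S : F -> E, [/\ ladjointable S, cancel T S & cancel S T].

Definition radjoint (E F : rightHilbertType B) (T : E -> F) (S : F -> E) : Prop :=
  forall (x : E) (y : F), rip (T x) y = rip x (S y) :> B.

Definition radjointable (E F : rightHilbertType B) (T : E -> F) : Prop :=
  exists S : F -> E, radjoint T S.

(* Isomorphism in the category of right Hilbert B-modules and B-adjointable
   operators; it need not preserve inner products. *)
Definition risomorphism (E F : rightHilbertType B) (T : E -> F) : Prop :=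
  radjointable T /\
  exists S : F -> E, [/\ radjointable S, cancel T S & cancel S T].

End HilbertOperators.

(* [B] as a right Hilbert module over itself. *)
Definition selfmod (R : realType) (B : cstarAlgType R) : Type := B.

Section SelfModule.
Variables (R : realType) (B : cstarAlgType R).

HB.instance Definition _ := GRing.Lmodule.copy (selfmod B) B.

Definition self_act (f : selfmod B) (b : B) : selfmod B := amul (f : B) b.
Definition self_ip (f g : selfmod B) : B := amul (astar (f : B)) g.

Let self_actDl (f g : selfmod B) (b : B) :
  self_act (f + g) b = self_act f b + self_act g b.
Proof. exact: amulDl. Qed.

Let self_actDr (f : selfmod B) (a b : B) :
  self_act f (a + b) = self_act f a + self_act f b.
Proof. exact: amulDr. Qed.

Let self_actZl (k : R[i]) (f : selfmod B) (b : B) :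
  self_act (k *: f) b = k *: self_act f b.
Proof. exact: amulZl. Qed.

Let self_actZr (k : R[i]) (f : selfmod B) (b : B) :
  self_act f (k *: b) = k *: self_act f b.
Proof. exact: amulZr. Qed.

Let self_actA (f : selfmod B) (a b : B) :
  self_act f (amul a b) = self_act (self_act f a) b.
Proof. exact: amulA. Qed.

Let self_ipDr (f g h : selfmod B) :
  self_ip f (g + h) = self_ip f g + self_ip f h.
Proof. exact: amulDr. Qed.

Let self_ipZr (k : R[i]) (f g : selfmod B) :
  self_ip f (k *: g) = k *: self_ip f g.
Proof. exact: amulZr. Qed.

Let self_ip_act (f g : selfmod B) (b : B) :
  self_ip f (self_act g b) = amul (self_ip f g) b.
Proof. exact: amulA. Qed.

Let self_ipC (f g : selfmod B) : astar (self_ip f g) = self_ip g f.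
Proof. by rewrite /self_ip astarM astarK. Qed.

Let self_ip_pos (f : selfmod B) : apos (self_ip f f).
Proof. by exists f. Qed.

Let self_ip_norm (f : selfmod B) : ip_norm self_ip f = `|f : B|.
Proof. by rewrite /ip_norm norm_astar_amul sqrCK. Qed.

Let self_ip_eq0 (f : selfmod B) : self_ip f f = 0 -> f = 0.
Proof.
move=> f0; have := norm_astar_amul (f : B).
rewrite [amul _ _]f0 normr0 => /esym/eqP.
by rewrite sqrf_eq0 normr_eq0 => /eqP.
Qed.

Let self_complete : complete_for (ip_norm self_ip).
Proof.
move=> u u_cauchy; pose v : nat -> B := u.
have v_cvg : cvg (v @ \oo).
  apply/cauchy_cvgP/cauchy_exP => e e0.
  have [n0 un0] := u_cauchy e e0.
  exists (v n0), n0 => // n /= n0n.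
  rewrite -ball_normE /ball_ /=.
  by have := un0 n0 n (leqnn _) n0n; rewrite self_ip_norm.
exists (lim (v @ \oo)) => e e0.
have /cvgrPdist_lt /(_ e e0) [n0 _ vn0] := v_cvg.
exists n0 => n n0n; rewrite self_ip_norm.
by have := vn0 n n0n; rewrite distrC.
Qed.

HB.instance Definition _ := isRightHilbert.Build R B (selfmod B)
  self_actDl self_actDr self_actZl self_actZr self_actA self_ipDr self_ipZr
  self_ip_act self_ipC self_ip_pos self_ip_eq0 self_complete.

End SelfModule.

Definition Theta (R : realType) (A : cstarAlgType R) (E : leftHilbertType A)
  (g : E) : E -> E := fun f => lact (lip f g : A) g.

Definition Phi (R : realType) (B : cstarAlgType R) (E : rightHilbertType B)
  (g : E) : E -> selfmod B := fun f => rip g f.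

Definition Phi_adj (R : realType) (B : cstarAlgType R) (E : rightHilbertType B)
  (g : E) : selfmod B -> E := fun b => ract g (b : B).

Lemma Phi_adjP (R : realType) (B : cstarAlgType R) (E : rightHilbertType B)
  (g : E) : radjoint (Phi g) (Phi_adj g).
Proof.
move=> f b; rewrite /Phi /Phi_adj rip_act.
by rewrite -(ripC g f).
Qed.

(* Main.v *)
Require Import Defs.
From mathcomp Require Import all_boot all_order all_algebra.
From mathcomp Require Import complex.
From mathcomp Require Import all_classical all_reals all_analysis.

(** Put [h = rip g g].  The imprimitivity identity [lip_rip] turns [Theta g] into
    right multiplication by [h] on [E], while [Phi g \o Phi_adj g] is left
    multiplication by [h] on [B].  Both conditions are therefore equivalent to
    a third one about the algebra alone: [B] has a unit and [h] is invertible
    in [B] ([linvertible_ThetaP], [risomorphism_PhiP]).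

    If [h] has an inverse [k], then multiplication by [k] inverts both
    operators, and its adjoint is multiplication by [astar k].

    Conversely, if left multiplication by [h] on [B] is bijective, the preimage
    of [h] is a left unit, hence a unit because of the involution, and the
    preimage of this unit is the inverse of [h].

    If instead [Theta g] is bijective, with inverse [S], then [S] inherits
    [A]-linearity and self-adjointness from [Theta g], whence, with [u = S g],
      [f <u, u> = <f, S g> S g = S (<S f, g> g) = S (Theta g (S f)) = S f].
    So [S] is right multiplication by [k = <u, u>].  Thus [h k] and [k h] act
    trivially on [E], so they fix all inner products by right multiplication,
    and by density they are right units of [B] ([ract_id_right_unit]). *)

Set Implicit Arguments.
Unset Strict Implicit.
Unset Printing Implicit Defensive.

Import Order.TTheory GRing.Theory Num.Theory.
Import numFieldNormedType.Exports.

Local Open Scope classical_set_scope.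
Local Open Scope ring_scope.
Local Open Scope complex_scope.

Section Units.
Variables (R : realType) (B : cstarAlgType R).
Implicit Types a b e h k : B.

Lemma amulBl a b c : amul (a - b) c = amul a c - amul b c :> B.
Proof. by rewrite -scaleN1r amulDl amulZl scaleN1r. Qed.

Definition right_unit e := forall b, amul b e = b.

Definition left_unit e := forall b, amul e b = b.

(** For any right unit [e] the self-adjoint element [astar e * e] is
    [astar e]. *)
Lemma right_unit_astar e : right_unit e -> astar e = e.
Proof.
move=> e1; have ee := e1 (astar e).
by rewrite -[RHS](astarK e) -[in RHS]ee astarM astarK ee.
Qed.

Lemma right_unit_left e : right_unit e -> left_unit e.
Proof.
move=> e1 b; apply: (can_inj (@astarK R B)).
by rewrite astarM (right_unit_astar e1) e1.
Qed.

Lemma left_unit_right e : left_unit e -> right_unit e.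
Proof.
move=> e1; have ae1 : right_unit (astar e).
  by move=> b; rewrite -{1}[b]astarK -astarM e1 astarK.
by have := ae1; rewrite -(right_unit_astar ae1) astarK.
Qed.

(** Invertibility without naming a unit: the two products are right units,
    hence both equal to the unit of the algebra. *)
Definition inverse_of h k := right_unit (amul h k) /\ right_unit (amul k h).

End Units.

Section Bimodule.
Variables (R : realType) (A B : cstarAlgType R) (E : equivBimodType A B).
Implicit Types (f g : E) (b e h k : B).

Lemma rip_inj f g : (forall x : E, rip x f = rip x g :> B) -> f = g.
Proof.
move=> fg; apply/eqP; rewrite -subr_eq0; apply/eqP/(@rip_eq0 R B E).
by rewrite -scaleN1r ripDr ripZr fg !scaleN1r subrr.
Qed.

Lemma right_unit_ract_id e : right_unit e -> forall f, ract f e = f.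
Proof. by move=> e1 f; apply: rip_inj => x; rewrite rip_act e1. Qed.

(** An element acting trivially on [E] fixes every inner product, hence their
    span, and right multiplication is continuous. *)
Lemma ract_id_right_unit e : (forall f, ract f e = f) -> right_unit e.
Proof.
move=> fe b.
have span_e x :
    lin_span [set b : B | exists f g : E, b = rip f g] x -> amul x e = x.
  move=> [n [c [y [yP ->]]]].
  elim/big_rec: _ => [|i u _ uv]; first by rewrite -(scale0r e) amulZl !scale0r.
  by have [p [q ->]] := yP i; rewrite amulDl uv amulZl -rip_act fe.
have c_gt0 : 0 < `|e| + 1 by rewrite ltr_wpDl.
apply/eqP; rewrite -subr_eq0 -normr_le0.
apply/ler_addgt0Pl => d d_gt0; rewrite addr0.
(* [amul b e - b = amul (b - x) e - (b - x)] for [x] in the span, so a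
   distance [d / (`|e| + 1)] from [b] to [x] suffices. *)
have r_gt0 : 0 < d / (`|e| + 1) by rewrite divr_gt0.
have [|x [bx /span_e xe]] :=
    @rip_dense R A B E (ball b (d / (`|e| + 1))) _ (@ball_open _ _ b _).
  by exists b; apply: ballxx.
have -> : amul b e - b = amul (b - x) e - (b - x).
  by rewrite amulBl xe opprB addrA subrK.
apply: (le_trans (ler_normB _ _)).
apply: (@le_trans _ _ (`|b - x| * (`|e| + 1))).
  by rewrite mulrDr mulr1 lerD2r norm_amul.
rewrite -ler_pdivlMr//; apply: ltW.
by move: bx; rewrite -ball_normE.
Qed.

Lemma ThetaE g f : Theta (g : E) f = ract f (rip g g : B).
Proof. exact: lip_rip. Qed.

Lemma Phi_Phi_adjE g b : (Phi g \o Phi_adj g) b = amul (rip g g) b.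
Proof. exact: rip_act. Qed.

Lemma ladjointable_ract b : ladjointable (fun f : E => ract f b).
Proof. by exists (fun f => ract f (astar b)) => x y; exact: lip_ract. Qed.

Lemma radjointable_amul b :
  radjointable (fun c : selfmod B => amul b c : selfmod B).
Proof.
exists (fun c : selfmod B => amul (astar b) c) => x y.
by rewrite /rip/= /self_ip astarM amulA.
Qed.

Section ThetaInverse.
Variables (g : E) (S : E -> E).
Hypotheses (TK : cancel (Theta g) S) (SK : cancel S (Theta g)).

Lemma Theta_inv_lact (a : A) f : S (lact a f) = lact a (S f).
Proof. by apply: (can_inj TK); rewrite SK ThetaE lractA -ThetaE SK. Qed.

(** Self-adjointness of [rip g g] makes [Theta g] symmetric for [lip], and the
    inverse of a symmetric bijection is symmetric. *)
Lemma Theta_inv_selfadj f f' : lip (S f) f' = lip f (S f') :> A.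
Proof.
by rewrite -{1}(SK f') ThetaE -(ripC g g) -lip_ract -ThetaE SK.
Qed.

(** The inverse of [Theta g] is again of the form [Theta u], with [u = S g]:
    move [S] across the inner product, then pull it out by [A]-linearity. *)
Lemma Theta_invE f : S f = ract f (rip (S g) (S g) : B).
Proof.
rewrite -lip_rip -Theta_inv_selfadj -Theta_inv_lact.
by rewrite -[lact _ g]/(Theta g _) SK.
Qed.

End ThetaInverse.

Lemma linvertible_ThetaP g :
  linvertible (Theta g : E -> E) <-> exists k, inverse_of (rip g g) k.
Proof.
have ThetaF : Theta g = fun f => ract f (rip g g : B).
  by apply/funext => f; exact: ThetaE.
split=> [[_ [S [_ TK SK]]]|[k [hk kh]]].
  exists (rip (S g) (S g)); split; apply: ract_id_right_unit => f.
    by rewrite ractA -ThetaE -(Theta_invE TK SK) TK.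
  by rewrite ractA -ThetaE -(Theta_invE TK SK) SK.
split; first by rewrite ThetaF; exact: ladjointable_ract.
exists (fun f => ract f k); split; first exact: ladjointable_ract.
  by move=> f; rewrite ThetaE -ractA right_unit_ract_id.
by move=> f; rewrite ThetaE -ractA right_unit_ract_id.
Qed.

Lemma risomorphism_PhiP g :
  risomorphism (Phi g \o Phi_adj g : selfmod B -> selfmod B) <->
  exists k, inverse_of (rip g g) k.
Proof.
set h : B := rip g g.
have PhiF : Phi g \o Phi_adj g = fun b : selfmod B => amul h b.
  by apply/funext => b; exact: Phi_Phi_adjE.
rewrite PhiF; split=> [[_ [S [_ TK SK]]]|[k [hk kh]]].
  have hS b : amul h (S b) = b by exact: SK.
  have h_inj (b c : B) : amul h b = amul h c -> b = c by apply: (can_inj TK).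
  (* [S h] solves [h x = h], so it is the candidate for the unit. *)
  have e1 : left_unit (S h : B) by move=> b; apply: h_inj; rewrite amulA hS.
  have e1r := left_unit_right e1.
  exists (S (S h)); split; first by rewrite hS.
  suff -> : amul (S (S h)) h = S h :> B by [].
  by apply: h_inj; rewrite amulA hS e1 hS.
split; first exact: radjointable_amul.
exists (fun b : selfmod B => amul k b); split; first exact: radjointable_amul.
  by move=> b; rewrite amulA right_unit_left.
by move=> b; rewrite amulA right_unit_left.
Qed.

End Bimodule.

Theorem proposition3p20 (R : realType) (A B : cstarAlgType R)
    (E : equivBimodType A B) (g : E) :
  linvertible (Theta g : E -> E) <->
  risomorphism (Phi g \o Phi_adj g : selfmod B -> selfmod B).
Proof. by rewrite linvertible_ThetaP risomorphism_PhiP. Qed.
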